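(* Let $k\geq 0$ be an integer, let $n$ and $m$ be nonnegative integers, and let $\epsilon_k$ be an integer with $0\leq \epsilon_k\leq \delta_k(n+m)$. Then the following statements hold: (a) $\partial_k(n)\leq m-\epsilon_k$ if and only if $n\leq \partial^k(n+m)$; (b) $n=\partial^k(n+m)$ if and only if $\partial_k(n)+\delta_k(n+m)=m$; (c) $\partial_k(n)=m$ if and only if $n=\partial^k(n+m)$ and $\delta_k(n+m)=0$.
   Context: For integers $k\geq 1$ and $N\geq 1$ there is a unique expansion $N=\binom{a_k}{k}+\binom{a_{k-1}}{k-1}+\cdots+\binom{a_i}{i}$ with integers $a_k>a_{k-1}>\cdots>a_i\geq i\geq 1$ (the $(k-1)$-dimensional representation of $N$). Using it define $\partial_{k-1}(N)=\sum_{t=i}^{k}\binom{a_t}{t-1}$, $\partial^{k-1}(N)=\sum_{t=i}^{k}\binom{a_t-1}{t}$, and $\delta_{k-1}(N)=\#\{t\in\{i,\ldots,k\}: a_t=t\}$; also set $\partial_{k-1}(0)=\partial^{k-1}(0)=\delta_{k-1}(0)=0$. (Binomial coefficients $\binom{p}{q}$ with $0\le p<q$ are $0$.) Thus for each integer $k\geq 0$, $\partial_k,\partial^k,\delta_k$ are functions on the nonnegative integers. *)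

(* Defs.v *)
From mathcomp Require Import all_boot all_order all_algebra.

Set Implicit Arguments.
Unset Strict Implicit.
Unset Printing Implicit Defensive.

(* The k-dimensional representation of N has top lower index k+1. Only the    *)
(* values of a on {i, ..., k+1} matter.                                       *)
Definition is_rep (k N i : nat) (a : nat -> nat) : bool :=
  [&& 0 < i <= k.+1, i <= a i,
      all (fun t => a t < a t.+1) (index_iota i k.+1)
    & N == \sum_(i <= t < k.+2) 'C(a t, t)].

Lemma eq_is_rep k N i a b :
  (forall t, i <= t <= k.+1 -> a t = b t) -> is_rep k N i a -> is_rep k N i b.
Proof.
move=> eqab /and4P[hi hai /allP hinc /eqP hN]; apply/and4P; split=> //.
- by case/andP: hi => _ hi; rewrite -eqab ?leqnn ?hi.
- apply/allP=> t ht; have:= hinc t ht; move: ht; rewrite mem_index_iota.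
  case/andP=> h1 h2; rewrite -!eqab ?h1 ?h2 ?(leqW h1) //.
  exact: ltnW.
- rewrite hN; apply/eqP; rewrite big_nat_cond [RHS]big_nat_cond.
  by apply: eq_bigr => t; rewrite andbT ltnS => /eqab ->.
Qed.

Lemma is_rep_recr k N i a : i <= k.+1 ->
  is_rep k.+1 N i a =
  [&& 'C(a k.+2, k.+2) <= N, a k.+1 < a k.+2
    & is_rep k (N - 'C(a k.+2, k.+2)) i a].
Proof.
move=> hi; rewrite /is_rep hi (leqW hi) big_nat_recr ?(leqW hi) //=.
have -> : index_iota i k.+2 = rcons (index_iota i k.+1) k.+1.
  by rewrite /index_iota subSn // -[(k.+1 - i).+1]addn1 iotaD /= subnKC // cats1.
rewrite all_rcons.
case: (0 < i); rewrite /= ?andbF //.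
case: (i <= a i); rewrite /= ?andbF //.
case: (a k.+1 < a k.+2); rewrite /= ?andbF //.
case: (all _ _); rewrite /= ?andbF //.
apply/eqP/andP=> [->|[h /eqP <-]]; first by rewrite leq_addl addnK.
by rewrite subnK.
Qed.

Lemma is_rep_top k N a :
  is_rep k N k.+1 a = (k < a k.+1) && (N == 'C(a k.+1, k.+1)).
Proof. by rewrite /is_rep /index_iota subnn big_nat1 leqnn. Qed.

Lemma is_rep_gt0 k N i a : is_rep k N i a -> 0 < N.
Proof.
case/and4P=> /andP[_ hi] hai _ /eqP->.
by rewrite big_nat_recl // addn_gt0 bin_gt0 hai.
Qed.

Lemma is_rep_bounds k N i a : is_rep k N i a ->
  'C(a k.+1, k.+1) <= N < 'C((a k.+1).+1, k.+1).
Proof.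
elim: k N => [|k IHk] N hr.
  have hi : i = 1 by case/and4P: hr => /andP[h1 h2] _ _ _; apply/eqP; rewrite eqn_leq h1 h2.
  move: hr; rewrite hi is_rep_top => /andP[_ /eqP->].
  by rewrite !bin1 leqnn ltnS leqnn.
have [hi|hi] := leqP i k.+1.
  move: hr; rewrite is_rep_recr // => /and3P[hC hlt /IHk/andP[_ hub]].
  rewrite hC binS -ltn_subLR //; apply: (leq_trans hub).
  exact: leq_bin2l.
have {}hi : i = k.+2.
  by case/and4P: hr => /andP[_ h2] _ _ _; apply/eqP; rewrite eqn_leq h2 hi.
move: hr; rewrite hi is_rep_top => /andP[hlt /eqP->].
by rewrite leqnn binS -{1}[X in X < _]addn0 ltn_add2l bin_gt0 ltnW.
Qed.

Lemma is_rep_top_uniq k N i j a b :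
  is_rep k N i a -> is_rep k N j b -> a k.+1 = b k.+1.
Proof.
move=> /is_rep_bounds/andP[ha1 ha2] /is_rep_bounds/andP[hb1 hb2].
apply/eqP; rewrite eqn_leq; apply/andP; split; rewrite leqNgt; apply/negP=> h.
- by have := leq_trans hb2 (leq_trans (leq_bin2l k.+1 h) ha1); rewrite ltnn.
- by have := leq_trans ha2 (leq_trans (leq_bin2l k.+1 h) hb1); rewrite ltnn.
Qed.

Lemma is_rep_uniq k N i j a b : is_rep k N i a -> is_rep k N j b ->
  i = j /\ (forall t, i <= t <= k.+1 -> a t = b t).
Proof.
elim: k N => [|k IHk] N ha hb; have hab := is_rep_top_uniq ha hb.
  have le1 l c : is_rep 0 N l c -> l = 1.
    by case/and4P=> /andP[h1 h2] _ _ _; apply/eqP; rewrite eqn_leq h1 h2.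
  rewrite (le1 _ _ ha) (le1 _ _ hb); split=> // t ht.
  by have -> : t = 1 by apply/eqP; rewrite eqn_leq andbC.
have top l c : is_rep k.+1 N l c -> k.+1 < l -> l = k.+2.
  by case/and4P=> /andP[_ h2] _ _ _ h; apply/eqP; rewrite eqn_leq h2.
have [hi|hi] := leqP i k.+1; have [hj|hj] := leqP j k.+1.
- move: ha hb; rewrite !is_rep_recr // hab => /and3P[_ _ ha] /and3P[_ _ hb].
  have [-> eqab] := IHk _ ha hb; split=> // t /andP[h1].
  rewrite leq_eqVlt ltnS => /orP[/eqP->//|h2].
  by apply: eqab; rewrite h1.
- move: (hb); rewrite (top _ _ hb hj) is_rep_top => /andP[_ /eqP hN].
  move: ha; rewrite is_rep_recr // => /and3P[_ _ /is_rep_gt0].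
  by rewrite hab hN subnn.
- move: (ha); rewrite (top _ _ ha hi) is_rep_top => /andP[_ /eqP hN].
  move: hb; rewrite is_rep_recr // => /and3P[_ _ /is_rep_gt0].
  by rewrite -hab hN subnn.
- rewrite (top _ _ ha hi) (top _ _ hb hj); split=> // t ht.
  by have -> : t = k.+2 by apply/eqP; rewrite eqn_leq andbC.
Qed.

Lemma bin_bracket k N : 0 < N ->
  exists c, k < c /\ 'C(c, k.+1) <= N < 'C(c.+1, k.+1).
Proof.
move=> N_gt0.
have h0 : exists c, 'C(c, k.+1) <= N by exists 0; rewrite bin0n.
have hb c : 'C(c, k.+1) <= N -> c <= k.+1 + N.
  move=> hc; rewrite leqNgt; apply/negP=> lt; move: hc; rewrite leqNgt.
  have hN M : M < 'C(k.+1 + M, k.+1).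
    elim: M => [|M IHM]; first by rewrite addn0 binn.
    by rewrite addnS binS -addn1 leq_add // bin_gt0 addSn leqW // leq_addr.
  by rewrite (leq_trans (hN N)) // leq_bin2l // ltnW.
case: (ex_maxnP h0 hb) => c hc hmax; exists c; split.
  by apply: hmax; rewrite binn.
rewrite hc ltnNge; apply/negP=> /hmax; by rewrite ltnn.
Qed.

Lemma is_rep_ex_fun k N : 0 < N -> exists i a, is_rep k N i a.
Proof.
elim: k N => [|k IHk] N N_gt0.
  by exists 1, (fun=> N); rewrite is_rep_top bin1 eqxx andbT.
have [c [hc /andP[h1 h2]]] := bin_bracket k.+1 N_gt0.
have [e|ne] := eqVneq N 'C(c, k.+2).
  by exists k.+2, (fun=> c); rewrite is_rep_top e eqxx andbT.
have lt : 'C(c, k.+2) < N by rewrite ltn_neqAle eq_sym ne.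
have [i [a ha]] := IHk (N - 'C(c, k.+2)) (ltac:(by rewrite subn_gt0)).
have hi : i <= k.+1 by case/and4P: (ha) => /andP[].
exists i, (fun t => if t == k.+2 then c else a t).
rewrite is_rep_recr // eqxx h1 /= [k.+1 == _]ltn_eqF // ; apply/andP; split.
  have /andP[lb _] := is_rep_bounds ha.
  rewrite ltnNge; apply/negP=> ge.
  have := leq_trans (leq_bin2l k.+1 ge) lb.
  by rewrite leq_subRL // -binS leqNgt h2.
apply: eq_is_rep ha => t /andP[_ ht].
by rewrite ltn_eqF.
Qed.

Lemma is_rep_ex k N :
  exists p : nat * seq nat, is_rep k N.+1 p.1 (nth 0 p.2).
Proof.
have [i [a ha]] := is_rep_ex_fun k (ltn0Sn N).
exists (i, mkseq a k.+2); apply: eq_is_rep ha => t /andP[_ ht].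
by rewrite nth_mkseq.
Qed.

(* The argument N stands for the representation of N.+1, so that it exists.   *)
Definition rep_start (k N : nat) : nat := (xchoose (is_rep_ex k N)).1.
Definition rep_coef (k N : nat) : nat -> nat :=
  nth 0 (xchoose (is_rep_ex k N)).2.

(* partial_lo, partial_up and delta are \partial_k, \partial^k and \delta_k.  *)
Definition partial_lo (k N : nat) : nat :=
  if N is N'.+1 then
    \sum_(rep_start k N' <= t < k.+2) 'C(rep_coef k N' t, t.-1)
  else 0.

(* The coefficients satisfy a_t >= t >= 1, so .-1 does not truncate.          *)
Definition partial_up (k N : nat) : nat :=
  if N is N'.+1 then
    \sum_(rep_start k N' <= t < k.+2) 'C((rep_coef k N' t).-1, t)
  else 0.

Definition delta (k N : nat) : nat :=
  if N is N'.+1 then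
    count (fun t => rep_coef k N' t == t) (index_iota (rep_start k N') k.+2)
  else 0.

Lemma rep_coefP k N : is_rep k N.+1 (rep_start k N) (rep_coef k N).
Proof. exact: xchooseP (is_rep_ex k N). Qed.

Lemma is_rep_partial_lo k N i a : is_rep k N i a ->
  partial_lo k N = \sum_(i <= t < k.+2) 'C(a t, t.-1).
Proof.
case: N => [/is_rep_gt0//|N] ha /=.
have [-> eqa] := is_rep_uniq (rep_coefP k N) ha.
rewrite big_nat_cond [RHS]big_nat_cond; apply: eq_bigr => t.
by rewrite andbT ltnS => /eqa ->.
Qed.

Lemma is_rep_partial_up k N i a : is_rep k N i a ->
  partial_up k N = \sum_(i <= t < k.+2) 'C((a t).-1, t).
Proof.
case: N => [/is_rep_gt0//|N] ha /=.
have [-> eqa] := is_rep_uniq (rep_coefP k N) ha.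
rewrite big_nat_cond [RHS]big_nat_cond; apply: eq_bigr => t.
by rewrite andbT ltnS => /eqa ->.
Qed.

Lemma is_rep_delta k N i a : is_rep k N i a ->
  delta k N = count (fun t => a t == t) (index_iota i k.+2).
Proof.
case: N => [/is_rep_gt0//|N] ha /=.
have [-> eqa] := is_rep_uniq (rep_coefP k N) ha.
apply: eq_in_count => t.
by rewrite mem_index_iota ltnS => /eqa ->.
Qed.

(* Main.v *)
Require Import Defs.
From mathcomp Require Import all_boot all_order all_algebra.
From mathcomp Require Import zify.

(** Write N = n + m, p = ∂^k(N) and f(x) = x + ∂_k(x).  The function f is
    strictly increasing.  In the representation of N the indices with a_t = t
    form an initial segment {i, ..., j-1}; deleting them and lowering the other
    a_t by one gives the representation of p, so Pascal's rule yields
    f(p) + δ_k(N) = N.  If δ_k(N) > 0, the representation of p + 1 is that of p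
    with the term C(j-1, j-1) added, so f(p + 1) = f(p) + j > N.  As
    ∂_k(n) <= m - e means f(n) <= N - e, all three statements follow by
    comparing f(n) with f(p) and f(p + 1). *)

Lemma is_rep_start_bounds k N i a : is_rep k N i a -> 0 < i <= k.+1.
Proof. by case/and4P. Qed.

Lemma is_rep_lt k N i a t : is_rep k N i a -> i <= t <= k -> a t < a t.+1.
Proof.
by case/and4P=> _ _ /allP h _ ht; apply: h; rewrite mem_index_iota ltnS.
Qed.

Lemma is_rep_ge k N i a t : is_rep k N i a -> i <= t <= k.+1 -> t <= a t.
Proof.
move=> ha; elim: t => [|t IHt] // /andP[it tk].
move: it; rewrite leq_eqVlt => /orP[/eqP <-|it]; first by case/and4P: ha.
by apply: leq_ltn_trans (is_rep_lt _ _ _ _ t ha _); [apply: IHt|]; lia.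
Qed.

(** By induction the terms below the top one sum to at most ['C(a k.+1, k.-1)] when k > 0, and
    Pascal's rule adds the top term. *)
Lemma partial_lo_le_bin k N i a : is_rep k N i a ->
  'C(a k.+1, k) <= partial_lo k N <= 'C((a k.+1).+1, k).
Proof.
move=> ha; rewrite (is_rep_partial_lo ha).
have /andP[_ hi] := is_rep_start_bounds _ _ _ _ ha.
rewrite big_nat_recr //= leq_addl /=.
elim: k N ha hi => [|k IHk] N ha hi.
  by rewrite big_geq ?bin0 //; case/andP: (is_rep_start_bounds _ _ _ _ ha).
have [hk|hk] := leqP i k.+1; last by rewrite big_geq // leq_bin2l.
move: ha; rewrite is_rep_recr // => /and3P[_ lt_top ha].
rewrite big_nat_recr //= binS addnC leq_add2l.
by apply: leq_trans (IHk _ ha hk) _; apply: leq_bin2l.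
Qed.

Lemma partial_lo_recr k N i a : is_rep k.+1 N i a ->
  partial_lo k.+1 N =
  'C(a k.+2, k.+1) + partial_lo k (N - 'C(a k.+2, k.+2)).
Proof.
move=> ha; rewrite (is_rep_partial_lo ha).
have /andP[_ hi] := is_rep_start_bounds _ _ _ _ ha.
rewrite big_nat_recr //= addnC; congr (_ + _).
have [hk|hk] := leqP i k.+1.
  by move: ha; rewrite is_rep_recr // => /and3P[_ _ /is_rep_partial_lo->].
(* The top term is the whole representation; the remainder is 0, where [partial_lo] is 0 by
   convention. *)
have ei : i = k.+2 by lia.
move: ha; rewrite ei is_rep_top => /andP[_ /eqP->].
by rewrite subnn big_geq.
Qed.

(** Compare top coefficients. If they differ, the binomial bounds decide; if they agree, remove the
    common top term and use induction on k. *)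
Lemma partial_lo_mono k n n' : n <= n' -> partial_lo k n <= partial_lo k n'.
Proof.
elim: k n n' => [|k IHk] [|n] // [|n'] // le_n.
all: have ha := rep_coefP _ n : is_rep _ _ _ _.
all: have hb := rep_coefP _ n' : is_rep _ _ _ _.
  (* For k = 0 both bounds are ['C(_, 0)], so [partial_lo] is 1 on positive numbers. *)
  have /andP[_ hn] := partial_lo_le_bin _ _ _ _ (ha 0).
  have /andP[hn' _] := partial_lo_le_bin _ _ _ _ (hb 0).
  by apply: leq_trans hn _; move: hn'; rewrite !bin0.
move: (ha k.+1) (hb k.+1) => {}ha {}hb.
have /andP[_ hn] := partial_lo_le_bin _ _ _ _ ha.
have /andP[hn' _] := partial_lo_le_bin _ _ _ _ hb.
have /andP[bn _] := is_rep_bounds ha.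
have /andP[_ bn'] := is_rep_bounds hb.
case: (ltngtP (rep_coef k.+1 n k.+2) (rep_coef k.+1 n' k.+2)) => [lt|gt|eq_top].
- by apply: leq_trans hn _; apply: leq_trans hn'; apply: leq_bin2l.
- by have := leq_trans bn' (leq_trans (leq_bin2l k.+2 gt) bn); lia.
- rewrite (partial_lo_recr _ _ _ _ ha) (partial_lo_recr _ _ _ _ hb) eq_top.
  by rewrite leq_add2l IHk // leq_sub2r.
Qed.

(** Since a is strictly increasing, once a_t > t this persists. So j is the first such index, or k +
    2 if there is none. *)
Lemma is_rep_fixed_prefix k N i a : is_rep k N i a ->
  exists j, [/\ i <= j <= k.+2, forall t, i <= t < j -> a t = t
              & forall t, j <= t <= k.+1 -> t < a t].
Proof.
move=> ha; have /andP[i0 ik] := is_rep_start_bounds _ _ _ _ ha.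
have exj : exists j, (i <= j) && ((j == k.+2) || (j < a j)).
  by exists k.+2; rewrite eqxx andbT; lia.
case: (ex_minnP exj) => j /andP[ij hj] min_j; exists j.
have jk : j <= k.+2 by apply: min_j; rewrite eqxx andbT; lia.
split=> [|t /andP[it tj]|]; first by rewrite ij.
  have := is_rep_ge _ _ _ _ t ha; rewrite it /= => /(_ ltac:(lia)) ta.
  apply/eqP; rewrite eqn_leq ta andbT leqNgt; apply/negP=> lt.
  by have := min_j t; rewrite it lt orbT /= => /(_ isT); lia.
elim=> [|t IHt] /andP[jt tk]; first by lia.
move: jt; rewrite leq_eqVlt => /orP[/eqP ej|jt].
  by move: hj; rewrite ej => /orP[/eqP|//]; lia.
apply: leq_trans (is_rep_lt _ _ _ _ t ha _); last by lia.
by rewrite ltnS; apply: IHt; lia.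
Qed.

(* The summand j - s counts the terms C(t, t), s <= t < j. *)
Lemma is_rep_lower k i j s a :
  0 < s <= j -> s <= k.+1 -> i <= j <= k.+2 ->
  (forall t, i <= t <= k -> a t < a t.+1) ->
  (forall t, j <= t <= k.+1 -> t < a t) ->
  is_rep k (j - s + \sum_(j <= t < k.+2) 'C((a t).-1, t)) s
    (fun t => if t < j then t else (a t).-1).
Proof.
move=> /andP[s0 sj] sk /andP[ij jk] a_lt a_gt; apply/and4P; split.
- by rewrite s0.
- by case: ltnP => // js; have := a_gt s; lia.
(* At the junction t + 1 = j, the bound j < a_j gives j - 1 < a_j - 1. *)
- apply/allP=> t; rewrite mem_index_iota ltnS => /andP[st tk].
  have := a_lt t; have := a_gt t; have := a_gt t.+1.
  by case: (ltnP t j); case: (ltnP t.+1 j); lia.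
rewrite [X in _ == X](big_cat_nat sj) //=; apply/eqP; congr (_ + _).
  rewrite -[LHS]muln1 -sum_nat_const_nat; apply: eq_big_nat => t /andP[_ ->].
  by rewrite binn.
by apply: eq_big_nat => t /andP[jt _]; rewrite ltnNge jt.
Qed.

(** Each term C(t, t) turns into C(t, t - 1) = t. The choice s = j serves p, and s = j - 1 serves p
    + 1. *)
Lemma partial_lo_lower k i j s a :
  0 < s <= j -> s <= k.+1 -> i <= j <= k.+2 ->
  (forall t, i <= t <= k -> a t < a t.+1) ->
  (forall t, j <= t <= k.+1 -> t < a t) ->
  partial_lo k (j - s + \sum_(j <= t < k.+2) 'C((a t).-1, t)) =
  \sum_(s <= t < j) t + \sum_(j <= t < k.+2) 'C((a t).-1, t.-1).
Proof.
move=> hs sk ij a_lt a_gt; case/andP: (hs) (ij) => s0 sj /andP[_ jk].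
rewrite (is_rep_partial_lo (is_rep_lower _ _ _ _ _ hs sk ij a_lt a_gt)).
rewrite (big_cat_nat sj) //=; congr (_ + _).
  apply: eq_big_nat => -[|t] /andP[st ->]; first by lia.
  by rewrite -bin_sub //= subSnn bin1.
by apply: eq_big_nat => t /andP[jt _]; rewrite ltnNge jt.
Qed.

(** This places N in the range f(p) <= N < f(p + 1) and identifies the gap N - f(p) as
    [delta k N]. *)
Lemma partial_up_spec k N :
  partial_up k N + partial_lo k (partial_up k N) + delta k N = N /\
  N < (partial_up k N).+1 + partial_lo k (partial_up k N).+1.
Proof.
case: N => [|N]; first by split.
have := rep_coefP k N; move: (rep_start k N) (rep_coef k N) => i a ha.
have /andP[i0 ik] := is_rep_start_bounds _ _ _ _ ha.
have [j [ij a_eq a_gt]] := is_rep_fixed_prefix _ _ _ _ ha.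
have /andP[ij1 jk] := ij.
have a_lt t := is_rep_lt _ _ _ _ t ha.
set U := \sum_(j <= t < k.+2) 'C((a t).-1, t).
set L := \sum_(j <= t < k.+2) 'C((a t).-1, t.-1).
(* The indices t < j contribute C(t - 1, t) = 0. *)
have upE : partial_up k N.+1 = U.
  rewrite (is_rep_partial_up ha) (big_cat_nat ij1) //= big_nat_cond big1 //.
  by move=> t /[!andbT] ht; rewrite a_eq // bin_small //; lia.
have deltaE : delta k N.+1 = j - i.
  rewrite (is_rep_delta ha) -sum1_count big_mkcond (big_cat_nat ij1) //=.
  rewrite [X in _ + X]big_nat_cond [X in _ + X]big1 => [|t]; last first.
    by rewrite andbT => /a_gt /gtn_eqF->.
  rewrite addn0 -[RHS]muln1 -sum_nat_const_nat; apply: eq_big_nat => t ht.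
  by rewrite a_eq // eqxx.
have NE : N.+1 = U + L + (j - i).
  case/and4P: (ha) => _ _ _ /eqP->; rewrite (big_cat_nat ij1) //= addnC.
  congr (_ + _); last first.
    rewrite -[RHS]muln1 -sum_nat_const_nat; apply: eq_big_nat => t ht.
    by rewrite a_eq // binn.
  rewrite -big_split; apply: eq_big_nat => t ht.
  have := a_gt t ht; case: (a t) => // b _.
  by case: t ht => [|t] ht; [lia | rewrite binS].
have loE : partial_lo k U = L.
  (* If j = k + 2, then U = 0 has no representation, and U = L = 0 settles the claim. *)
  have [jk1|kj] := leqP j k.+1; last by rewrite /U /L !big_geq.
  rewrite -[U]add0n -(subnn j) (partial_lo_lower _ i) ?leqnn ?andbT //; last lia.
  by rewrite big_geq.
rewrite upE deltaE loE; split; first by rewrite NE.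
(* If j = i, then N = f(U) and monotonicity suffices. *)
have [ji|lt_ij] := leqP j i.
  by have := partial_lo_mono k U U.+1 (leqnSn _); rewrite loE; lia.
(* Taking s = j - 1 >= i >= 1 gives f(U + 1) = U + L + j, which exceeds U + L + (j - i) because i >
   0. *)
have -> : U.+1 = j - j.-1 + U by lia.
rewrite (partial_lo_lower _ i) //; try lia.
rewrite -/L -[X in \sum_(_ <= t < X) t](ltn_predK lt_ij) big_nat1; lia.
Qed.

Theorem theorem1p3 (k n m : nat) (e : int)
    (he : (0 <= e <= (delta k (n + m))%:Z)%R) :
  [/\ ((partial_lo k n)%:Z <= m%:Z - e)%R <-> n <= partial_up k (n + m),
      n = partial_up k (n + m) <-> partial_lo k n + delta k (n + m) = m
    & partial_lo k n = m <-> n = partial_up k (n + m) /\ delta k (n + m) = 0].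
Proof.
have [up_eq up_lt] := partial_up_spec k (n + m).
move: he up_eq up_lt.
move: (partial_up k _) (delta k _) => p d he up_eq up_lt.
(* With N = n + m: n <= p gives f(n) <= f(p) = N - d <= N - e, strictly below f(p) if n < p, while n
   > p gives f(n) >= f(p + 1) > N. *)
have le_p : n <= p -> partial_lo k n <= partial_lo k p.
  exact: partial_lo_mono.
have ge_p : p <= n -> partial_lo k p <= partial_lo k n.
  exact: partial_lo_mono.
have gt_p : p < n -> partial_lo k p.+1 <= partial_lo k n.
  exact: partial_lo_mono.
have eq_p : n = p -> partial_lo k n = partial_lo k p by move->.
by split; split; lia.
Qed.
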